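(* Let $B$ be a discrete abelian group (written additively), $\alpha\in\mathrm{Aut}(B)$, $G=B\rtimes_\alpha\mathbb{Z}$, $K=\widehat{B}$, and let $\chi\in K$. Assume the orbit of $\chi$ under the action of $\widehat{\alpha}$ has finite order $p$, i.e. $\widehat{\alpha}^p\chi=\chi$ and $\widehat{\alpha}^k\chi\ne\chi$ for all $1\le k<p$. Then the commutant $M_p=\{\mathrm{Ind}_B^G(\chi)\}'$ of the induced representation is abelian, and $M_p$ does not contain minimal projections.
   Context: $G=B\rtimes_\alpha\mathbb{Z}$ is the set of pairs $(j,b)$, $j\in\mathbb{Z}$, $b\in B$, with multiplication $(k,c)(j,b)=(k+j,\alpha^k(b)+c)$; $B$ is identified with the subgroup $\{(0,b)\}$. $K=\widehat{B}$ is the compact group of characters $\chi:B\to\mathbb{T}$, and $\widehat{\alpha}\in\mathrm{Aut}(K)$ is the dual action $(\widehat{\alpha}\chi)(b)=\chi(\alpha(b))$. The induced representation $\mathrm{Ind}_B^G(\chi)$ acts on the Hilbert space of functions $f:G\to\mathbb{C}$ with $f(j,b)=\chi(b)f(j,0)$ and $\|f\|^2=\sum_{j\in\mathbb{Z}}|f(j,0)|^2<\infty$, by right translation $(\mathrm{Ind}_B^G(\chi)_{g}f)(x)=f(xg)$. Equivalently, on $l^2(\mathbb{Z})$ it is given by $(\mathrm{Ind}_B^G(\chi)_{(j,b)}\xi)_k=\chi(\alpha^k(b))\xi_{k+j}$. The commutant of a representation is the von Neumann algebra of all bounded operators commuting with every operator of the representation. A minimal projection of a von Neumann algebra $M$ is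 a nonzero projection $P\in M$ such that the only projections $Q\in M$ with $Q\le P$ are $0$ and $P$. *)

(* Defs.v *)
From HB Require Import structures.
From mathcomp Require Import all_boot all_order all_algebra.
From mathcomp Require Import complex ring lra.
From mathcomp Require Import all_classical all_reals all_analysis.

Set Implicit Arguments.
Unset Strict Implicit.
Unset Printing Implicit Defensive.

Import Order.TTheory GRing.Theory Num.Theory.
Import numFieldNormedType.Exports.

Local Open Scope classical_set_scope.
Local Open Scope ring_scope.
Local Open Scope complex_scope.

(* Automorphisms of an abelian group carry their (unique) inverse, so that all
   integer powers can be written down without choice. *)
Record aut (B : zmodType) := Aut {
  aut_fun :> {additive B -> B};
  aut_inv : B -> B;
  autK : cancel aut_fun aut_inv;
  autVK : cancel aut_inv aut_fun }.

Definition semidirect (B : zmodType) (alpha : aut B) : Type := (int * B)%type.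

Section SemidirectProduct.
Variables (B : zmodType) (alpha : aut B).

Definition aut_pow (k : int) : B -> B :=
  match k with
  | Posz n => iter n alpha
  | Negz n => iter n.+1 (aut_inv alpha)
  end.

Lemma aut_powS k b : aut_pow (k + 1) b = alpha (aut_pow k b).
Proof.
case: k => [n|[|n]]; rewrite ?NegzE.
- by rewrite -[1]/(Posz 1) -PoszD addn1.
- by rewrite /= autVK.
- have -> : - n.+2%:Z + 1 = Negz n.
    by rewrite NegzE -[n.+2]addn1 PoszD opprD subrK.
  by rewrite -NegzE /= autVK.
Qed.

Lemma aut_powD j k b : aut_pow (j + k) b = aut_pow j (aut_pow k b).
Proof.
have VS i c : aut_pow (i - 1) c = aut_inv alpha (aut_pow i c).
  by rewrite -[in RHS](subrK 1 i) aut_powS autK.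
elim/int_ind: j => [|n IH|n IH]; first by rewrite add0r.
  by rewrite -addn1 PoszD addrAC !aut_powS IH.
by rewrite -addn1 PoszD opprD addrAC !VS IH.
Qed.

Lemma aut_pow_morphD k : {morph aut_pow k : b c / b + c}.
Proof.
have iD n : {morph iter n alpha : b c / b + c}.
  by elim: n => // n IH b c; rewrite !iterS -raddfD; congr (alpha _); exact: IH.
have VD : {morph aut_inv alpha : b c / b + c}.
  by move=> b c; rewrite -{1}(autVK alpha b) -{1}(autVK alpha c) -raddfD autK.
have iVD n : {morph iter n (aut_inv alpha) : b c / b + c}.
  by elim: n => // n IH b c; rewrite !iterS -VD; congr (aut_inv _ _); exact: IH.
by case: k => n; [exact: iD | exact: (iVD n.+1)].
Qed.

HB.instance Definition _ := Choice.copy (semidirect alpha) (int * B)%type.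

Local Notation G := (semidirect alpha).

Definition sd_mul (x y : G) : G :=
  (x.1 + y.1, aut_pow x.1 y.2 + x.2).

Definition sd_one : G := (0, 0).

Definition sd_inv (x : G) : G :=
  (- x.1, - aut_pow (- x.1) x.2).

Lemma aut_pow0 k : aut_pow k 0 = 0.
Proof. by apply: (@addrI _ (aut_pow k 0)); rewrite -aut_pow_morphD !addr0. Qed.

Lemma aut_powN k b : aut_pow k (- b) = - aut_pow k b.
Proof. by apply/eqP; rewrite -addr_eq0 -aut_pow_morphD addNr aut_pow0. Qed.

Lemma sd_mulA : associative sd_mul.
Proof.
move=> [i a] [j b] [k c]; rewrite /sd_mul /=.
by rewrite addrA aut_pow_morphD aut_powD addrA.
Qed.

Lemma sd_mul1 : left_id sd_one sd_mul.
Proof. by move=> [i a]; rewrite /sd_mul /= add0r addr0. Qed.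

Lemma sd_mulr1 : right_id sd_one sd_mul.
Proof. by move=> [i a]; rewrite /sd_mul /= aut_pow0 addr0 add0r. Qed.

Lemma sd_mulV : left_inverse sd_one sd_inv sd_mul.
Proof. by move=> [i a]; rewrite /sd_mul /= addNr subrr. Qed.

Lemma sd_mulrV : right_inverse sd_one sd_inv sd_mul.
Proof.
by move=> [i a]; rewrite /sd_mul /= aut_powN -aut_powD subrr addNr.
Qed.

HB.instance Definition _ := isGroup.Build G
  sd_mulA sd_mul1 sd_mulr1 sd_mulV sd_mulrV.

End SemidirectProduct.

Section Dual.
Variables (R : realType) (B : zmodType).

Definition is_character (chi : B -> R[i]) : Prop :=
  (forall b, `|chi b| = 1) /\ (forall b c, chi (b + c) = chi b * chi c).

(* As B is discrete, every character is continuous. *)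
Definition dual_group : Type := {chi : B -> R[i] | `[< is_character chi >]}.

Definition char_fun (chi : dual_group) : B -> R[i] := sval chi.
Coercion char_fun : dual_group >-> Funclass.

Lemma char_norm (chi : dual_group) b : `|chi b| = 1.
Proof. by have /asboolP[] := svalP chi. Qed.

Lemma charD (chi : dual_group) b c : chi (b + c) = chi b * chi c.
Proof. by have /asboolP[_] := svalP chi; exact. Qed.

Lemma char_inj (chi psi : dual_group) : (chi =1 psi) -> chi = psi.
Proof. by move=> e; apply: val_inj; apply/funext. Qed.

Variable alpha : aut B.

Lemma dual_act_subproof (chi : dual_group) :
  `[< is_character (fun b => chi (alpha b)) >].
Proof.
apply/asboolP; split=> [b|b c]; first exact: char_norm.
by rewrite raddfD charD.
Qed.

Definition dual_act (chi : dual_group) : dual_group :=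
  exist _ (fun b => chi (alpha b)) (dual_act_subproof chi).

End Dual.

(* |z|^2 as an element of R *)
Definition sqnormc (R : realType) (z : R[i]) : R :=
  complex.Re z ^+ 2 + complex.Im z ^+ 2.

Lemma sqnormcE (R : realType) (z : R[i]) : (sqnormc z)%:C = `|z| ^+ 2.
Proof. by rewrite normc_def -rmorphXn /= sqr_sqrtr ?addr_ge0 ?sqr_ge0. Qed.

Lemma sqnormc_ge0 (R : realType) (z : R[i]) : 0 <= sqnormc z.
Proof. by rewrite addr_ge0 ?sqr_ge0. Qed.

Lemma sqnormcM (R : realType) (z w : R[i]) :
  sqnormc (z * w) = sqnormc z * sqnormc w.
Proof.
apply: (@complexI R); rewrite [RHS]rmorphM /= !sqnormcE.
by rewrite normrM exprMn.
Qed.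

Lemma sqnormcD (R : realType) (z w : R[i]) :
  sqnormc (z + w) <= 2 * sqnormc z + 2 * sqnormc w.
Proof.
case: z w => [a b] [c d]; rewrite /sqnormc /=.
rewrite -subr_ge0.
have -> : 2 * (a ^+ 2 + b ^+ 2) + 2 * (c ^+ 2 + d ^+ 2)
    - ((a + c) ^+ 2 + (b + d) ^+ 2) = (a - c) ^+ 2 + (b - d) ^+ 2.
  by rewrite !sqrrD !sqrrN !mulr2n !mulrN; ring.
by rewrite addr_ge0 ?sqr_ge0.
Qed.

(* Sum of an (absolutely summable) family of complex numbers indexed by the
   integers, computed as the limit of its symmetric partial sums. *)
Definition sumZ (R : realType) (u : int -> R[i]) : R[i] :=
  let S n := \sum_(k < n.*2.+1) u (k%:Z - n%:Z) in
  limn (fun n => complex.Re (S n)) +i* limn (fun n => complex.Im (S n)).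

Section InducedRepresentation.
Variables (R : realType) (B : zmodType) (alpha : aut B) (chi : dual_group R B).

Local Notation G := (semidirect alpha).

Definition sqsum (f : G -> R[i]) : \bar R :=
  (\esum_(j in [set: int]) (sqnormc (f (j, 0)))%:E)%E.

Definition ind_pred : {pred (G -> R[i]^o)} := fun f =>
  `[< (forall j b, f (j, b) = chi b * f (j, 0)) /\ (sqsum f < +oo)%E >].

Lemma ind_predP (f : G -> R[i]^o) : reflect
  ((forall j b, f (j, b) = chi b * f (j, 0)) /\ (sqsum f < +oo)%E)
  (f \in ind_pred).
Proof. exact: asboolP. Qed.

Lemma sqsum_ge0 (f : G -> R[i]) : (0 <= sqsum f)%E.
Proof. by apply: esum_ge0 => j _; rewrite lee_fin sqnormc_ge0. Qed.

Lemma sqsumZ_le (a : R[i]) (f : G -> R[i]) :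
  (sqsum (fun x => a * f x)%R <= (sqnormc a)%:E * sqsum f)%E.
Proof.
apply: ge_ereal_sup => _ [A [finA _] <-].
rewrite (eq_fsbigr (fun j => ((sqnormc a)%:E * (sqnormc (f (j, 0)))%:E)%E)).
  rewrite -ge0_mule_fsumr; last by move=> j; rewrite lee_fin sqnormc_ge0.
  by apply: lee_wpmul2l; rewrite ?lee_fin ?sqnormc_ge0 //; apply: esum_ge;
     exists A.
by move=> j _; rewrite sqnormcM EFinM.
Qed.

Lemma sqsumD_le (f g : G -> R[i]) :
  (sqsum (fun x => f x + g x)%R
     <= sqsum f + sqsum f + (sqsum g + sqsum g))%E.
Proof.
have ge0 h j : [set: int] j -> (0 <= (sqnormc (h (j, 0%R) : R[i]))%:E)%E.
  by rewrite lee_fin sqnormc_ge0.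
rewrite /sqsum -!esumD; do ?by move=> j jT; rewrite ?adde_ge0 ?ge0.
apply: le_esum => j _; rewrite -!EFinD lee_fin.
by apply: le_trans (sqnormcD _ _) _; rewrite !mulr_natl !mulr2n.
Qed.

Lemma ind_submod : GRing.subsemimod_closed ind_pred.
Proof.
split; [split|].
- apply/ind_predP; split=> [j b|]; first by rewrite mulr0.
  by rewrite /sqsum esum1 ?ltry // => j _; rewrite /sqnormc /= expr0n addr0.
- move=> f g /ind_predP[fE fs] /ind_predP[gE gs]; apply/ind_predP.
  split=> [j b|]; first by rewrite !fctE fE gE mulrDr.
  by apply: le_lt_trans (sqsumD_le f g) _; rewrite !lte_add_pinfty.
- move=> a f /ind_predP[fE fs]; apply/ind_predP.
  split=> [j b|]; first by rewrite /= !fctE fE /GRing.scale /= mulrCA.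
  apply: le_lt_trans (sqsumZ_le a f) _.
  rewrite lte_mul_pinfty ?lee_fin ?sqnormc_ge0 //.
Qed.

HB.instance Definition _ := GRing.isSubSemiModClosed.Build
  R[i] (G -> R[i]^o) ind_pred ind_submod.

(* The Hilbert space of the induced representation; its norm and inner product
   are ind_norm and ind_inner below. *)
Record ind_space : Type := IndSpace {
  ind_fun :> G -> R[i]^o;
  _ : ind_fun \in ind_pred }.

HB.instance Definition _ := [isSub for ind_fun].
HB.instance Definition _ := [Choice of ind_space by <:].
HB.instance Definition _ := [SubChoice_isSubLmodule of ind_space by <:].

Definition ind_norm (f : ind_space) : R := Num.sqrt (fine (sqsum f)).

Definition ind_inner (f g : ind_space) : R[i] :=
  sumZ (fun j => (f (j, 0) : R[i]) * ((g (j, 0) : R[i])^*)%C).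

Lemma ind_subproof (g : G) (f : ind_space) :
  (fun x : G => f (x * g)%g) \in ind_pred.
Proof.
have /ind_predP[fE fs] := valP f; apply/ind_predP; case: g => [l c].
have fM j b : f (((j, b) : G) * ((l, c) : G))%g =
    chi (aut_pow alpha j c + b) * f (j + l, 0) by rewrite -fE.
split=> [j b|]; first by rewrite !fM addr0 addrC charD mulrA.
rewrite [X in (X < _)%E](_ : _ = sqsum f) // /sqsum.
rewrite [RHS](@reindex_esum _ _ _ [set: int] [set: int] (fun j => j + l)); last first.
  split=> //; first by move=> i j _ _ /addIr.
  by move=> j _; exists (j - l); rewrite ?subrK.
apply: eq_esum => j _; rewrite fM sqnormcM.
have chi1 b : sqnormc (chi b) = 1.
  by apply: (@complexI R); rewrite sqnormcE char_norm expr1n.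
by rewrite chi1 mul1r.
Qed.

Definition Ind (g : G) (f : ind_space) : ind_space :=
  IndSpace (ind_subproof g f).

Definition bounded_operator (T : ind_space -> ind_space) : Prop :=
  linear T /\ exists M : R, forall f, ind_norm (T f) <= M * ind_norm f.

Definition projection (P : ind_space -> ind_space) : Prop :=
  [/\ bounded_operator P,
      forall f, P (P f) = P f &
      forall f g, ind_inner (P f) g = ind_inner f (P g)].

(* In R[i], x <= y means that y - x is a nonnegative real number. *)
Definition operator_le (S T : ind_space -> ind_space) : Prop :=
  forall f, ind_inner (S f) f <= ind_inner (T f) f.

Definition minimal_projection (M : set (ind_space -> ind_space))
    (P : ind_space -> ind_space) : Prop :=
  [/\ M P, projection P, P <> (fun=> 0) &
      forall Q, M Q -> projection Q -> operator_le Q P ->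
        Q = (fun=> 0) \/ Q = P].

Definition Ind_commutant : set (ind_space -> ind_space) :=
  [set T | bounded_operator T /\ forall g f, T (Ind g f) = Ind g (T f)].

End InducedRepresentation.

Arguments Ind_commutant {R B} alpha chi _.

(* Main.v *)
Require Import Defs.
From HB Require Import structures.
From mathcomp Require Import all_boot all_order all_algebra.
From mathcomp Require Import complex ring lra zify.
From mathcomp Require Import all_classical all_reals all_analysis.

Set Implicit Arguments.
Unset Strict Implicit.
Unset Printing Implicit Defensive.

Import Order.TTheory GRing.Theory Num.Theory.
Import numFieldNormedType.Exports.

Local Open Scope classical_set_scope.
Local Open Scope ring_scope.

(** The relations of the group enter through two facts.  An operator in the
    commutant commutes with the bilateral shift [Ind (1, 0)], so its matrix in
    the basis [delta] is Toeplitz: it is convolution by its symbol [T (delta 0)]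
    ([commutant_Toeplitz]).  Conversely, a bounded convolution operator whose
    symbol lives on the multiples of [p] also commutes with the diagonal
    operators [Ind (0, b)], because the diagonal entries
    [chi (aut_pow alpha k b)] are [p]-periodic in [k].

    The commutant is therefore abelian, because convolution is commutative
    ([commutant_comm]); matrices suffice here since the truncations of a vector
    converge to it in norm ([bounded_matrix]).

    On the Fourier side the commutant consists of multiplication operators on
    the circle, and it is diffuse because of the Rademacher functions.  No
    Fourier transform is used: the multiplier by the square wave of frequency
    [q] is convolution by the discrete Hilbert kernel, supported on the odd
    multiples of [q] and proportional to [i / m] there.  Its translates are
    orthonormal ([wave_family_orth]): the sum of [1 / ((j - k) (j - l))] is
    split by partial fractions into two sums of an odd function.  Together with
    the hermitian symmetry of the kernel this makes the multiplier a
    self-adjoint involution ([analysis_symmetry]), and it belongs to the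
    commutant as soon as [p] divides [q] ([wave_symmetry]).

    Let [P] be a minimal projection and [h = P (delta 0)], so that
    [h_0 = |h|^2].  For a self-adjoint involution [W] of the commutant,
    [P (1 + W) / 2] is a subprojection of [P], hence is [0] or [P], and thus
    [P W = P] or [P W = - P] ([minimal_symmetry]).  Applied to the waves of
    frequency [p 2^n], whose symbols [e n] have disjoint supports and so are
    orthonormal, this says that [<h, e n>] has the modulus of [h_0] for every
    [n].  Bessel's inequality forces [h_0 = 0], so [h = 0] and [P = 0]. *)

(** * Symmetric windows of integers *)

Definition window (n : nat) : seq int :=
  [seq k%:Z - n%:Z | k <- iota 0 n.*2.+1].

Lemma window_uniq n : uniq (window n).
Proof. by rewrite map_inj_uniq ?iota_uniq // => a b /addIr []. Qed.

Lemma mem_window n j : (j \in window n) = (`|j|%N <= n)%N.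
Proof.
apply/mapP/idP => [[k]|jn]; first by rewrite mem_iota => ? ->; lia.
by exists (absz (j + n%:Z)); rewrite ?mem_iota; lia.
Qed.

(** These are the partial sums whose limit [sumZ] takes. *)
Definition wsum (V : zmodType) (u : int -> V) (n : nat) : V :=
  \sum_(j <- window n) u j.

Section WindowSums.
Variable V : zmodType.
Implicit Types u v : int -> V.

Lemma wsum_ord u n : wsum u n = \sum_(k < n.*2.+1) u (k%:Z - n%:Z).
Proof.
by rewrite /wsum big_map -[iota _ _]/(index_iota 0 n.*2.+1) big_mkord.
Qed.

Lemma wsum0 u : wsum u 0 = u 0.
Proof. by rewrite wsum_ord big_ord1 subr0. Qed.

Lemma wsumS u n : wsum u n.+1 = wsum u n + u n.+1%:Z + u (- n.+1%:Z).
Proof.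
rewrite !wsum_ord doubleS big_ord_recl big_ord_recr /= [LHS]addrC.
congr (_ + _).
  congr (_ + _); last by congr u; rewrite /bump /=; lia.
  by apply: eq_bigr => i _; congr u; rewrite /bump /=; lia.
by congr u; lia.
Qed.

Lemma wsum_shift1 u n :
  wsum (fun j => u (j + 1)) n = wsum u n + u n.+1%:Z - u (- n%:Z).
Proof.
elim: n => [|n IH]; first by rewrite !wsum0 add0r oppr0 addrAC subrr add0r.
rewrite !wsumS IH.
have -> : - n.+1%:Z + 1 = - n%:Z by lia.
have -> : n.+1%:Z + 1 = n.+2%:Z by lia.
by rewrite [_ + u (- n.+1%:Z) + _]addrAC addrK addrAC subrK.
Qed.

Lemma wsum_opp u n : wsum (fun j => u (- j)) n = wsum u n.
Proof.
elim: n => [|n IH]; first by rewrite !wsum0 oppr0.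
by rewrite !wsumS IH opprK addrAC.
Qed.

Lemma wsumD u v n : wsum (fun j => u j + v j) n = wsum u n + wsum v n.
Proof. exact: big_split. Qed.

Lemma wsumB u v n : wsum (fun j => u j - v j) n = wsum u n - wsum v n.
Proof. by rewrite /wsum sumrB. Qed.

End WindowSums.

Lemma wsum_homo (R : realType) (u : int -> R) :
  (forall j, 0 <= u j) -> {homo wsum u : m n / (m <= n)%N >-> m <= n}.
Proof.
move=> u0; apply: homo_leq => [//|y x z|n]; first exact: le_trans.
by rewrite wsumS -addrA lerDl addr_ge0.
Qed.

(** * Limits of complex sequences *)

Section ComplexLimits.
Variable R : realType.
Local Notation C := R[i].
Implicit Types (s t : nat -> C) (l m a : C).
Local Open Scope complex_scope.

Lemma ReD a l : complex.Re (a + l) = complex.Re a + complex.Re l.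
Proof. by case: a l => [? ?] []. Qed.

Lemma ImD a l : complex.Im (a + l) = complex.Im a + complex.Im l.
Proof. by case: a l => [? ?] []. Qed.

Lemma ReN a : complex.Re (- a) = - complex.Re a.
Proof. by case: a. Qed.

Lemma ImN a : complex.Im (- a) = - complex.Im a.
Proof. by case: a. Qed.

Lemma ReM a l : complex.Re (a * l) =
  complex.Re a * complex.Re l - complex.Im a * complex.Im l.
Proof. by case: a l => [? ?] []. Qed.

Lemma ImM a l : complex.Im (a * l) =
  complex.Re a * complex.Im l + complex.Im a * complex.Re l.
Proof. by case: a l => [? ?] []. Qed.

Lemma Re_wsum (u : int -> C) n :
  complex.Re (wsum u n) = wsum (fun j => complex.Re (u j)) n.
Proof. exact: (big_morph _ ReD). Qed.

Lemma Im_wsum (u : int -> C) n :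
  complex.Im (wsum u n) = wsum (fun j => complex.Im (u j)) n.
Proof. exact: (big_morph _ ImD). Qed.

Lemma complex_ext a l :
  complex.Re a = complex.Re l -> complex.Im a = complex.Im l -> a = l.
Proof. by case: a l => [? ?] [? ?] /= -> ->. Qed.

Lemma sqnormc_eq0 a : sqnormc a = 0 -> a = 0.
Proof.
by move=> a0; apply/eqP; rewrite -normr_eq0 -sqrf_eq0 -sqnormcE a0.
Qed.

Lemma sqnormc_conj a : sqnormc (a^*)%C = sqnormc a.
Proof. by case: a => x y; rewrite /sqnormc /= sqrrN. Qed.

Lemma mulc_conj a : a * (a^*)%C = (sqnormc a)%:C.
Proof. by case: a => x y; apply: complex_ext; rewrite /sqnormc /=; ring. Qed.

Lemma sqnormcN a : sqnormc (- a) = sqnormc a.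
Proof. by rewrite /sqnormc ReN ImN !sqrrN. Qed.

(** The limit is taken on real and imaginary parts separately, which is how
    [sumZ] computes. *)
Definition ccvg s l :=
  (complex.Re (s n) @[n --> \oo] --> complex.Re l) /\
  (complex.Im (s n) @[n --> \oo] --> complex.Im l).

Lemma ccvg_unique s l m : ccvg s l -> ccvg s m -> l = m.
Proof.
move=> [r1 i1] [r2 i2]; have H := @norm_hausdorff _ R.
by apply: complex_ext;
  [rewrite -(cvg_lim H r1) (cvg_lim H r2)
  |rewrite -(cvg_lim H i1) (cvg_lim H i2)].
Qed.

Lemma eq_ccvg s t l : s =1 t -> ccvg s l -> ccvg t l.
Proof. by move=> /funext ->. Qed.

Lemma ccvg_cst l : ccvg (fun=> l) l.
Proof. by split; exact: cvg_cst. Qed.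

Lemma ccvgD s t l m : ccvg s l -> ccvg t m -> ccvg (fun n => s n + t n) (l + m).
Proof.
move=> [? ?] [? ?]; split.
- by under eq_cvg do rewrite ReD; rewrite ReD; apply: cvgD.
- by under eq_cvg do rewrite ImD; rewrite ImD; apply: cvgD.
Qed.

Lemma ccvgN s l : ccvg s l -> ccvg (fun n => - s n) (- l).
Proof.
move=> [? ?]; split.
- by under eq_cvg do rewrite ReN; rewrite ReN; apply: cvgN.
- by under eq_cvg do rewrite ImN; rewrite ImN; apply: cvgN.
Qed.

Lemma ccvgM s t l m : ccvg s l -> ccvg t m -> ccvg (fun n => s n * t n) (l * m).
Proof.
move=> [? ?] [? ?]; split.
- by under eq_cvg do rewrite ReM; rewrite ReM; apply: cvgB; apply: cvgM.
- by under eq_cvg do rewrite ImM; rewrite ImM; apply: cvgD; apply: cvgM.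
Qed.

Lemma ccvg_conj s l : ccvg s l -> ccvg (fun n => (s n)^*)%C (l^*)%C.
Proof.
have ReJ a : complex.Re (a^*)%C = complex.Re a by case: a.
have ImJ a : complex.Im (a^*)%C = - complex.Im a by case: a.
move=> [? ?]; split.
- by under eq_cvg do rewrite ReJ; rewrite ReJ.
- by under eq_cvg do rewrite ImJ; rewrite ImJ; apply: cvgN.
Qed.

Lemma ccvg0 s : sqnormc (s n) @[n --> \oo] --> (0 : R) -> ccvg s 0.
Proof.
move=> s0; suff H (f : C -> R) : (forall a, f a ^+ 2 <= sqnormc a) ->
    f (s n) @[n --> \oo] --> (0 : R).
  split; apply: H => a; rewrite /sqnormc; [rewrite lerDl|rewrite lerDr];
  exact: sqr_ge0.
move=> fle; apply/cvgrPdist_lt => e e0.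
move/cvgrPdist_lt: s0 => /(_ (e ^+ 2)) [|N _ HN]; first exact: exprn_gt0.
exists N => // n /HN /=; rewrite !sub0r !normrN ger0_norm ?sqnormc_ge0 // => h.
have := le_lt_trans (fle _) h.
by rewrite -real_normK ?num_real // ltr_pXn2r // nnegrE ltW.
Qed.

Lemma ccvg_dist s l :
  sqnormc (l - s n) @[n --> \oo] --> (0 : R) -> ccvg s l.
Proof.
move=> /ccvg0 h; have := ccvgD (ccvg_cst l) (ccvgN h).
by rewrite subr0; apply: eq_ccvg => n; rewrite opprB addrC subrK.
Qed.

(** Shifting a family by one changes its window sums only by two boundary
    terms, so a family with this property has shift-invariant sums.  The
    quantifier over [k] makes the property itself invariant under shifts. *)
Definition vanishing (u : int -> C) := forall k : int,
  (sqnormc (u (n%:Z + k)) @[n --> \oo] --> (0 : R)) /\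
  (sqnormc (u (- n%:Z + k)) @[n --> \oo] --> (0 : R)).

Lemma vanishing_shift u k : vanishing u -> vanishing (fun j => u (j + k)).
Proof.
move=> vu i; have [h1 h2] := vu (i + k); split;
  by under eq_cvg do rewrite -addrA.
Qed.

Lemma vanishing_bound u (v : int -> C) (c : R) :
  (forall j, sqnormc (u j) <= c * sqnormc (v j)) -> vanishing v -> vanishing u.
Proof.
have bnd (x y : nat -> C) : (forall n, sqnormc (x n) <= c * sqnormc (y n)) ->
    sqnormc (y n) @[n --> \oo] --> (0 : R) ->
    sqnormc (x n) @[n --> \oo] --> (0 : R).
  move=> xy y0; apply: (@squeeze_cvgr _ _ _ _ (fun=> 0)
      (fun n => c * sqnormc (y n))); last 2 first.
  - exact: cvg_cst.
  - by rewrite -[X in _ --> X](mulr0 c); apply: cvgM y0; exact: cvg_cst.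
  by near=> n; rewrite sqnormc_ge0 xy.
move=> uv vv k; have [h1 h2] := vv k.
by split; [apply: bnd h1|apply: bnd h2].
Unshelve. all: by end_near. Qed.

Lemma ccvg_wsum_shift u l : vanishing u -> ccvg (wsum u) l ->
  forall k, ccvg (wsum (fun j => u (j + k))) l.
Proof.
move=> vu ul.
have up v : vanishing v -> ccvg (wsum v) l ->
    ccvg (wsum (fun j => v (j + 1))) l.
  move=> vv vl; have [/ccvg0 h1 _] := vv 1; have [_ /ccvg0 h2] := vv 0.
  have := ccvgD (ccvgD vl h1) (ccvgN h2); rewrite subr0 addr0.
  apply: eq_ccvg => n; rewrite wsum_shift1 addr0.
  by rewrite -addn1 PoszD.
have down v : vanishing v -> ccvg (wsum v) l ->
    ccvg (wsum (fun j => v (j - 1))) l.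
  move=> vv vl; have [/ccvg0 h1 _] := vv 0; have [_ /ccvg0 h2] := vv (-1).
  have := ccvgD (ccvgD vl (ccvgN h1)) h2; rewrite subr0 addr0.
  apply: eq_ccvg => n; rewrite addr0.
  have -> : wsum v n = wsum (fun j => v (j + 1 - 1)) n.
    by apply: eq_bigr => j _; rewrite addrK.
  rewrite (wsum_shift1 (fun j => v (j - 1))).
  have -> : n.+1%:Z - 1 = n%:Z by lia.
  by rewrite [_ + v n%:Z - _]addrAC addrK subrK.
elim/int_ind => [|n IH|n IH]; first by under eq_fun do rewrite addr0.
- have := up _ (vanishing_shift n%:Z vu) IH.
  by apply: eq_ccvg => m; apply: eq_bigr => j _; congr u; lia.
- have := down _ (vanishing_shift (- n%:Z) vu) IH.
  by apply: eq_ccvg => m; apply: eq_bigr => j _; congr u; lia.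
Qed.

End ComplexLimits.

(** * The Hilbert space of the induced representation *)

Section HilbertSpace.
Variables (R : realType) (B : zmodType) (alpha : aut B) (chi : dual_group R B).
Local Notation C := R[i].
Local Notation G := (semidirect alpha).
Local Notation H := (ind_space alpha chi).
Local Open Scope complex_scope.

Definition entry (f : H) (j : int) : C := ind_fun f ((j, 0) : G).
Arguments entry f j : simpl never.

Lemma ind_funE (f : H) j b : ind_fun f ((j, b) : G) = chi b * entry f j.
Proof. by have /ind_predP[-> _] := valP f. Qed.

Lemma ind_ext (f g : H) : entry f =1 entry g -> f = g.
Proof.
move=> fg; apply: val_inj; apply/funext => -[j b].
by rewrite /= !ind_funE fg.
Qed.

Lemma entryD (f g : H) j : entry (f + g) j = entry f j + entry g j.
Proof. by []. Qed.

Lemma entryZ a (f : H) j : entry (a *: f) j = a * entry f j.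
Proof. by []. Qed.

Lemma entry0 j : entry 0 j = 0.
Proof. by []. Qed.

Lemma entryN (f : H) j : entry (- f) j = - entry f j.
Proof. by rewrite -scaleN1r entryZ mulN1r. Qed.

Lemma entryB (f g : H) j : entry (f - g) j = entry f j - entry g j.
Proof. by rewrite entryD entryN. Qed.

Lemma entry_sum (I : Type) (r : seq I) (F : I -> H) j :
  entry (\sum_(i <- r) F i) j = \sum_(i <- r) entry (F i) j.
Proof. exact: (big_morph (entry^~ j) (fun f g => entryD f g j) (entry0 j)). Qed.

Definition nrm2 (f : H) : R := fine (sqsum f).

Lemma sqsum_fin (f : H) : (nrm2 f)%:E = sqsum f.
Proof.
have /ind_predP[_ fs] := valP f.
by rewrite /nrm2 fineK // ge0_fin_numE ?sqsum_ge0.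
Qed.

Lemma sqsum_le_window (f : G -> C) (c : R) :
  (forall n, wsum (fun j => sqnormc (f (j, 0))) n <= c) ->
  (sqsum f <= c%:E)%E.
Proof.
move=> fc; apply: ge_ereal_sup => _ [A [/finite_seqP[s ->] _] <-].
(* A finite set of integers lies in the window of its largest modulus. *)
pose n := (\max_(j <- s) `|j|%N)%N.
have := @lee_fsum_nneg_subset R _ [set` s] [set` window n]
  (fun j => (sqnormc (f (j, 0)))%:E) (finite_seq s) (finite_seq _).
have E : (\sum_(j \in [set` window n]) (sqnormc (f (j, 0%R)))%:E =
    (wsum (fun j => sqnormc (f (j, 0%R))) n)%:E)%E.
  by rewrite -fsbig_seq ?window_uniq // sumEFin.
rewrite E.
move=> le_s.
apply: le_trans (_ : (wsum (fun j => sqnormc (f (j, 0%R))) n)%:E <= _)%E;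
  [apply: le_s|by rewrite lee_fin].
- move=> j; rewrite !inE /= => js; rewrite mem_window.
  exact: (leq_bigmax_seq (F := fun j => `|j|%N)).
- by move=> j _; rewrite lee_fin sqnormc_ge0.
Qed.

Lemma wsum_nrm2_le (f : H) n :
  wsum (fun j => sqnormc (entry f j)) n <= nrm2 f.
Proof.
rewrite -lee_fin sqsum_fin; apply: esum_ge.
exists [set` window n]; first by split => //; exact: finite_seq.
by rewrite -fsbig_seq ?window_uniq // sumEFin.
Qed.

Lemma nrm2_cvg (f : H) :
  wsum (fun j => sqnormc (entry f j)) n @[n --> \oo] --> nrm2 f.
Proof.
set u := wsum _.
have u_nd : {homo u : m n / (m <= n)%N >-> m <= n}.
  by apply: wsum_homo => j; exact: sqnormc_ge0.
have u_cvg : cvgn u.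
  apply: nondecreasing_is_cvgn => //.
  by exists (nrm2 f) => _ [n _ <-]; exact: wsum_nrm2_le.
suff -> : nrm2 f = limn u by [].
apply/eqP; rewrite eq_le; apply/andP; split.
- rewrite -lee_fin sqsum_fin; apply: sqsum_le_window => n.
  exact: nondecreasing_cvgn_le.
- by apply: limr_le => //; apply: nearW => n; exact: wsum_nrm2_le.
Qed.

Lemma nrm2_le (f : H) (c : R) :
  (forall n, wsum (fun j => sqnormc (entry f j)) n <= c) -> nrm2 f <= c.
Proof. by rewrite -lee_fin sqsum_fin; exact: sqsum_le_window. Qed.

Lemma nrm2_ge0 (f : H) : 0 <= nrm2 f.
Proof. by rewrite -lee_fin sqsum_fin sqsum_ge0. Qed.

Lemma entry_le (f : H) j : sqnormc (entry f j) <= nrm2 f.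
Proof.
apply: le_trans (wsum_nrm2_le f `|j|%N).
rewrite /wsum (big_rem j) /= ?mem_window // lerDl.
by apply: sumr_ge0 => i _; exact: sqnormc_ge0.
Qed.

Lemma nrm2_eq0 (f : H) : nrm2 f = 0 -> f = 0.
Proof.
move=> f0; apply: ind_ext => j; rewrite entry0; apply: sqnormc_eq0.
by apply/eqP; rewrite eq_le sqnormc_ge0 -f0 entry_le.
Qed.

Lemma char0 : chi 0 = 1.
Proof.
have n0 : chi 0 != 0 by rewrite -normr_eq0 char_norm oner_eq0.
by apply: (mulIf n0); rewrite -charD addr0 mul1r.
Qed.

Lemma of_seq_subproof (x : int -> C) (c : R) :
  (forall n, wsum (fun j => sqnormc (x j)) n <= c) ->
  (fun g : G => chi g.2 * x g.1 : C^o) \in @ind_pred R B alpha chi.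
Proof.
move=> xc; apply/ind_predP; split=> [j b|]; first by rewrite /= char0 mul1r.
apply: (@le_lt_trans _ _ c%:E); last exact: ltry.
by apply: sqsum_le_window => n /=; rewrite char0; under eq_fun do rewrite mul1r.
Qed.

Definition of_seq (x : int -> C) (c : R)
  (xc : forall n, wsum (fun j => sqnormc (x j)) n <= c) : H :=
  IndSpace (of_seq_subproof xc).

Lemma entry_of_seq x c xc j : entry (@of_seq x c xc) j = x j.
Proof. by rewrite /entry /= char0 mul1r. Qed.

Lemma entry_cvg0 (f : H) :
  (sqnormc (entry f n%:Z) @[n --> \oo] --> (0 : R)) /\
  (sqnormc (entry f (- n%:Z)) @[n --> \oo] --> (0 : R)).
Proof.
have d0 : wsum (fun j => sqnormc (entry f j)) n.+1 -
    wsum (fun j => sqnormc (entry f j)) n @[n --> \oo] --> (0 : R).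
  rewrite -[X in _ --> X](subrr (nrm2 f)); apply: cvgB; last exact: nrm2_cvg.
  have := @nrm2_cvg f; rewrite -cvg_shiftS; exact.
(* Both boundary terms are dominated by the increment of the window sums. *)
suff sq (u : nat -> R) : (forall n, 0 <= u n) -> (forall n, u n.+1 <=
    wsum (fun j => sqnormc (entry f j)) n.+1 -
    wsum (fun j => sqnormc (entry f j)) n) -> u n @[n --> \oo] --> (0 : R).
  split; apply: sq => n; rewrite ?sqnormc_ge0 // wsumS.
    by have := sqnormc_ge0 (entry f (- n.+1%:Z)); lra.
  by have := sqnormc_ge0 (entry f n.+1%:Z); lra.
move=> u0 ud; rewrite -cvg_shiftS.
apply: (@squeeze_cvgr _ _ _ _ (fun=> 0) _ _ _ _ _ d0); last exact: cvg_cst.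
by near=> n; rewrite u0 ud.
Unshelve. all: by end_near. Qed.

(** * The inner product *)

Local Notation inner := (@ind_inner R B alpha chi).

Lemma wsum_entryE (f g : H) n :
  complex.Re (wsum (fun j => entry f j * (entry g j)^*)%C n) =
  (wsum (fun j => sqnormc (entry (f + g) j)) n -
   wsum (fun j => sqnormc (entry (f - g) j)) n) / 4.
Proof.
rewrite Re_wsum -wsumB /wsum mulr_suml; apply: eq_bigr => j _.
rewrite entryD entryB /sqnormc; case: (entry f j) (entry g j) => [a b] [c d] /=.
by field.
Qed.

Lemma wsum_Re_cvg (f g : H) :
  complex.Re (wsum (fun j => entry f j * (entry g j)^*)%C n) @[n --> \oo]
    --> (nrm2 (f + g) - nrm2 (f - g)) / 4.
Proof.
under eq_cvg do rewrite wsum_entryE.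
by apply: cvgM; [apply: cvgB; exact: nrm2_cvg|exact: cvg_cst].
Qed.

Lemma wsum_Im_cvg (f g : H) :
  complex.Im (wsum (fun j => entry f j * (entry g j)^*)%C n) @[n --> \oo]
    --> (nrm2 (f + 'i *: g) - nrm2 (f - 'i *: g)) / 4.
Proof.
have -> : (fun n =>
      complex.Im (wsum (fun j => entry f j * (entry g j)^*)%C n)) =
    (fun n => complex.Re
       (wsum (fun j => entry f j * (entry ('i *: g) j)^*)%C n)).
  apply/funext => n; rewrite Re_wsum Im_wsum; apply: eq_bigr => j _.
  rewrite entryZ; case: (entry f j) (entry g j) => [a b] [c d] /=; ring.
exact: wsum_Re_cvg.
Qed.

(** Polarization gives the convergence of the sum defining the inner product
    from that of the norms; it also shows that isometries preserve it. *)
Lemma inner_polar (f g : H) : inner f g =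
  (nrm2 (f + g) - nrm2 (f - g)) / 4 +i*
  ((nrm2 (f + 'i *: g) - nrm2 (f - 'i *: g)) / 4).
Proof.
have E n : \sum_(k < n.*2.+1)
    ((f (k%:Z - n%:Z, 0) : C) * ((g (k%:Z - n%:Z, 0) : C)^*)%C) =
    wsum (fun j => entry f j * (entry g j)^*)%C n by rewrite wsum_ord.
rewrite /ind_inner /sumZ; congr (_ +i* _); apply: cvg_lim => //.
  by under eq_cvg do rewrite E; exact: wsum_Re_cvg.
by under eq_cvg do rewrite E; exact: wsum_Im_cvg.
Qed.

Lemma inner_cvg (f g : H) :
  ccvg (wsum (fun j => entry f j * (entry g j)^*)%C) (inner f g).
Proof.
by rewrite inner_polar; split; [exact: wsum_Re_cvg|exact: wsum_Im_cvg].
Qed.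

Lemma inner_unique (f g : H) l :
  ccvg (wsum (fun j => entry f j * (entry g j)^*)%C) l -> inner f g = l.
Proof. exact: ccvg_unique (inner_cvg f g). Qed.

Lemma innerDl (f g h : H) : inner (f + g) h = inner f h + inner g h.
Proof.
apply: inner_unique.
apply: eq_ccvg (ccvgD (inner_cvg f h) (inner_cvg g h)) => n.
by rewrite -wsumD; apply: eq_bigr => j _; rewrite entryD mulrDl.
Qed.

Lemma innerZl a (f h : H) : inner (a *: f) h = a * inner f h.
Proof.
apply: inner_unique; apply: eq_ccvg (ccvgM (ccvg_cst a) (inner_cvg f h)) => n.
by rewrite /wsum mulr_sumr; apply: eq_bigr => j _; rewrite entryZ mulrA.
Qed.

Lemma inner_conj (f g : H) : inner g f = (inner f g)^*.
Proof.
apply: inner_unique; apply: eq_ccvg (ccvg_conj (inner_cvg f g)) => n.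
rewrite /wsum rmorph_sum; apply: eq_bigr => j _.
by rewrite rmorphM /= conjcK mulrC.
Qed.

Lemma innerNl (f h : H) : inner (- f) h = - inner f h.
Proof. by rewrite -scaleN1r innerZl mulN1r. Qed.

Lemma innerBl (f g h : H) : inner (f - g) h = inner f h - inner g h.
Proof. by rewrite innerDl innerNl. Qed.

Lemma innerDr (f g h : H) : inner h (f + g) = inner h f + inner h g.
Proof. by rewrite !(inner_conj _ h) innerDl rmorphD. Qed.

Lemma innerZr a (f h : H) : inner h (a *: f) = a^* * inner h f.
Proof. by rewrite !(inner_conj _ h) innerZl rmorphM. Qed.

Lemma inner_nrm2 (f : H) : inner f f = (nrm2 f)%:C.
Proof.
apply: inner_unique.
have E n : wsum (fun j => entry f j * (entry f j)^*)%C n =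
    (wsum (fun j => sqnormc (entry f j)) n)%:C.
  by rewrite /wsum rmorph_sum; apply: eq_bigr => j _; rewrite mulc_conj.
split; under eq_cvg do rewrite E; first exact: nrm2_cvg.
exact: cvg_cst.
Qed.

Lemma nrm2B (f g : H) :
  nrm2 (f - g) = nrm2 f + nrm2 g - complex.Re (inner f g) *+ 2.
Proof.
apply: (@complexI R); rewrite -inner_nrm2 innerBl.
rewrite !(inner_conj (f - g)) !innerBl !inner_nrm2.
rewrite (inner_conj f g); case: (inner f g) => a b.
by apply: complex_ext => /=; rewrite ?mulr2n; ring.
Qed.

Lemma nrm2Z a (f : H) : nrm2 (a *: f) = sqnormc a * nrm2 f.
Proof.
apply: (@complexI R); rewrite -inner_nrm2 innerZl innerZr inner_nrm2.
by rewrite mulrA mulc_conj rmorphM.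
Qed.

(** Stated as an equality because both consequences are used: Bessel's
    inequality, and the norm of the remainder of a truncation. *)
Lemma pythagoras (I : eqType) (e : I -> H) (r : seq I) (f : H) :
  (forall i j, inner (e i) (e j) = (i == j)%:R) -> uniq r ->
  nrm2 (f - \sum_(i <- r) inner f (e i) *: e i) =
  nrm2 f - \sum_(i <- r) sqnormc (inner f (e i)).
Proof.
move=> eo; elim: r f => [|i r IH] f; first by rewrite !big_nil !subr0.
rewrite !big_cons /= => /andP[ir ur]; set c := inner f (e i).
have fe j : j \in r -> inner (f - c *: e i) (e j) = inner f (e j).
  move=> jr; rewrite innerBl innerZl eo; case: eqP => [ij|_].
    by rewrite ij jr in ir.
  by rewrite mulr0 subr0.
have -> : nrm2 f - (sqnormc c + \sum_(j <- r) sqnormc (inner f (e j))) =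
    nrm2 (f - c *: e i) -
    \sum_(j <- r) sqnormc (inner (f - c *: e i) (e j)).
  rewrite opprD addrA; congr (_ - _).
    rewrite nrm2B nrm2Z innerZr -/c [_^* * _]mulrC mulc_conj /=.
    have -> : nrm2 (e i) = 1.
      by apply: (@complexI R); rewrite -inner_nrm2 eo eqxx.
    by rewrite mulr2n; ring.
  by rewrite big_seq [RHS]big_seq; apply: eq_bigr => j jr; rewrite fe.
rewrite -IH // opprD addrA; congr (nrm2 (_ - _)).
by rewrite big_seq [RHS]big_seq; apply: eq_bigr => j jr; rewrite fe.
Qed.

Lemma bessel (I : eqType) (e : I -> H) (r : seq I) (f : H) :
  (forall i j, inner (e i) (e j) = (i == j)%:R) -> uniq r ->
  \sum_(i <- r) sqnormc (inner f (e i)) <= nrm2 f.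
Proof. by move=> eo ur; rewrite -subr_ge0 -pythagoras // nrm2_ge0. Qed.

End HilbertSpace.

Arguments entry {R B alpha chi} f j : simpl never.

(** * Matrix entries of bounded operators *)

Section Operators.
Variables (R : realType) (B : zmodType) (alpha : aut B) (chi : dual_group R B).
Local Notation C := R[i].
Local Notation G := (semidirect alpha).
Local Notation H := (ind_space alpha chi).
Local Notation inner := (@ind_inner R B alpha chi).
Local Notation bounded := (@bounded_operator R B alpha chi).
Local Open Scope complex_scope.

Lemma sum_indicator (V : nzRingType) (r : seq int) k (F : int -> V) : uniq r ->
  \sum_(j <- r) (j == k)%:R * F j = (k \in r)%:R * F k.
Proof.
elim: r => [|a r IH]; first by rewrite big_nil mul0r.
rewrite big_cons inE => /andP[ar /IH ->]; rewrite eq_sym.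
by case: eqP ar => [->|_] ar; rewrite ?(negPf ar) /= ?mul0r ?addr0 ?add0r.
Qed.

Lemma sqnormc_bool (b : bool) : sqnormc (b%:R : C) = b%:R.
Proof. by case: b; rewrite /sqnormc /= ?expr1n ?expr0n ?addr0. Qed.

Lemma delta_subproof (k : int) n :
  wsum (fun j => sqnormc ((j == k)%:R : C)) n <= 1.
Proof.
rewrite /wsum (eq_bigr (fun j => (j == k)%:R * 1)); last first.
  by move=> j _; rewrite sqnormc_bool mulr1.
by rewrite sum_indicator ?window_uniq // mulr1; case: (_ \in _).
Qed.

Definition delta (k : int) : H := of_seq alpha chi (delta_subproof k).

Lemma entry_delta k j : entry (delta k) j = (j == k)%:R.
Proof. exact: entry_of_seq. Qed.

Lemma inner_deltar (f : H) k : inner f (delta k) = entry f k.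
Proof.
apply: inner_unique; apply: ccvg_dist; apply: cvg_near_cst.
exists `|k|%N => // n /= kn.
rewrite /wsum (eq_bigr (fun j => (j == k)%:R * entry f j)); last first.
  move=> j _; rewrite entry_delta mulrC; case: (j == k) => //=.
    by rewrite rmorph1.
  by rewrite rmorph0.
rewrite sum_indicator ?window_uniq // mem_window kn mul1r subrr.
exact: (sqnormc_bool false).
Qed.

Lemma inner_deltal (f : H) k : inner (delta k) f = (entry f k)^*.
Proof. by rewrite inner_conj inner_deltar. Qed.

Lemma inner_delta i j : inner (delta i) (delta j) = (i == j)%:R.
Proof. by rewrite inner_deltar entry_delta eq_sym. Qed.

Lemma sum_entry_le (f : H) (r : seq int) : uniq r ->
  \sum_(j <- r) sqnormc (entry f j) <= nrm2 f.
Proof.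
move=> ur; under eq_bigr do rewrite -inner_deltar.
by apply: bessel => // i j; exact: inner_delta.
Qed.

Lemma linearP2 (T : H -> H) : linear T ->
  [/\ {morph T : f g / f + g}, (forall a f, T (a *: f) = a *: T f),
      {morph T : f g / f - g} & T 0 = 0].
Proof.
move=> lT.
have lD : {morph T : f g / f + g}.
  by move=> f g; rewrite -[f in LHS]scale1r lT scale1r.
have l0 : T 0 = 0 by apply: (@addrI _ (T 0)); rewrite -lD !addr0.
have lZ a f : T (a *: f) = a *: T f.
  by rewrite -[_ *: f]addr0 lT l0 addr0.
by split => // f g; rewrite lD -scaleN1r lZ scaleN1r.
Qed.

Lemma linear_wsum (T : H -> H) (u : int -> H) n : linear T ->
  T (wsum u n) = wsum (T \o u) n.
Proof.
by move=> /linearP2[lD _ _ l0]; rewrite /wsum; exact: (big_morph T lD l0).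
Qed.

Lemma ind_normE (f : H) : ind_norm f = Num.sqrt (nrm2 f). Proof. by []. Qed.

Lemma boundedP (T : H -> H) : bounded T <->
  linear T /\ exists M, 0 <= M /\ forall f, nrm2 (T f) <= M * nrm2 f.
Proof.
split=> -[lT [M HM]]; split => //; last first.
  case: HM => M0 HM; exists (Num.sqrt M) => f; rewrite !ind_normE.
  by rewrite -sqrtrM // ler_wsqrtr.
exists (M ^+ 2); split=> [|f]; first exact: sqr_ge0.
have := HM f; rewrite !ind_normE => h.
have N0 := nrm2_ge0.
rewrite -(sqr_sqrtr (N0 _ _ _ _ f)) -(sqr_sqrtr (N0 _ _ _ _ (T f))) -exprMn.
by rewrite ler_pXn2r // nnegrE ?sqrtr_ge0 // (le_trans _ h) ?sqrtr_ge0.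
Qed.

Lemma bounded_linear (T : H -> H) : bounded T -> linear T.
Proof. by case. Qed.

Lemma bounded_comp (S T : H -> H) : bounded S -> bounded T -> bounded (S \o T).
Proof.
move=> /boundedP[lS [M [M0 HS]]] /boundedP[lT [N [N0 HT]]]; apply/boundedP.
split=> [a f g|]; first by rewrite /= lT lS.
exists (M * N); split=> [|f /=]; first exact: mulr_ge0.
by apply: le_trans (HS _) _; rewrite -mulrA ler_wpM2l.
Qed.

Lemma bounded_id : bounded id.
Proof.
by apply/boundedP; split=> //; exists 1; split=> // f; rewrite mul1r.
Qed.

Lemma nrm2D_le (f g : H) : nrm2 (f + g) <= 2 * nrm2 f + 2 * nrm2 g.
Proof.
apply: nrm2_le => n; rewrite -[leRHS]mulrDr.
have fg := lerD (wsum_nrm2_le f n) (wsum_nrm2_le g n).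
apply: le_trans (ler_wpM2l _ fg) => //.
rewrite -wsumD /wsum mulr_sumr; apply: ler_sum => j _.
by rewrite entryD mulrDr; exact: sqnormcD.
Qed.

Lemma bounded_comb a b (S T : H -> H) : bounded S -> bounded T ->
  bounded (fun f => a *: S f + b *: T f).
Proof.
move=> /boundedP[lS [M [M0 HS]]] /boundedP[lT [N [N0 HT]]]; apply/boundedP.
split=> [c f g|].
  rewrite lS lT !scalerDr addrACA !scalerA.
  by rewrite [c * a]mulrC [c * b]mulrC.
exists (2 * (sqnormc a * M) + 2 * (sqnormc b * N)); split=> [|f].
  by rewrite addr_ge0 // !mulr_ge0 ?sqnormc_ge0.
apply: le_trans (nrm2D_le _ _) _; rewrite !nrm2Z [leRHS]mulrDl -!mulrA.
by apply: lerD; rewrite !ler_wpM2l ?sqnormc_ge0.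
Qed.

(** Truncations [sum_(|j| <= n) f_j delta_j] converge to [f] in norm, so a
    bounded operator is given by its matrix. *)
Lemma bounded_matrix (T : H -> H) (f : H) k : bounded T ->
  ccvg (wsum (fun j => entry f j * entry (T (delta j)) k)) (entry (T f) k).
Proof.
move=> /boundedP[lT [M [M0 HT]]]; have [_ lZ lB _] := linearP2 lT.
pose fn n := wsum (fun j => entry f j *: delta j) n.
have fnE n : wsum (fun j => entry f j * entry (T (delta j)) k) n =
    entry (T (fn n)) k.
  rewrite linear_wsum // /wsum entry_sum; apply: eq_bigr => j _.
  by rewrite /= lZ entryZ.
have dE n : nrm2 (f - fn n) = nrm2 f - wsum (fun j => sqnormc (entry f j)) n.
  have := pythagoras f inner_delta (window_uniq n).
  under [in LHS]eq_bigr do rewrite inner_deltar.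
  by under [in RHS]eq_bigr do rewrite inner_deltar.
apply: ccvg_dist; apply: (@squeeze_cvgr _ _ _ _ (fun=> 0)
  (fun n => M * (nrm2 f - wsum (fun j => sqnormc (entry f j)) n))).
- near=> n; rewrite sqnormc_ge0 fnE -entryB -lB -dE /=.
  exact: le_trans (entry_le _ _) (HT _).
- exact: cvg_cst.
rewrite -[X in _ --> X](mulr0 M) -[X in _ * X](subrr (nrm2 f)).
by apply: cvgM; [|apply: cvgB; [|exact: nrm2_cvg]]; exact: cvg_cst.
Unshelve. all: by end_near. Qed.

Lemma bounded_ext (S T : H -> H) : bounded S -> bounded T ->
  (forall j, S (delta j) = T (delta j)) -> S = T.
Proof.
move=> bS bT ST; apply/funext => f; apply: ind_ext => k.
apply: ccvg_unique (bounded_matrix f k bS) _.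
by under eq_fun do rewrite ST; exact: bounded_matrix.
Qed.

Lemma vanishing_entry (f : H) : vanishing (entry f).
Proof.
have shift k : exists g : H, forall j, entry g j = entry f (j + k).
  have gb n : wsum (fun j => sqnormc (entry f (j + k))) n <= nrm2 f.
    rewrite /wsum -(big_map (fun j => j + k) xpredT
      (fun j => sqnormc (entry f j))) sum_entry_le //.
    by rewrite map_inj_uniq ?window_uniq // => i j /addIr.
  by exists (of_seq alpha chi gb) => j; exact: entry_of_seq.
move=> k; have [g gE] := shift k.
by have [h1 h2] := entry_cvg0 g; split;
  [move: h1|move: h2]; under eq_cvg do rewrite gE.
Qed.

(** * The commutant *)

Lemma entry_Ind l c (f : H) j :
  entry (Ind ((l, c) : G) f) j = chi (aut_pow alpha j c) * entry f (j + l).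
Proof. by rewrite -ind_funE -[aut_pow _ _ _]addr0. Qed.

Lemma bounded_Ind (g : G) : bounded (Ind g).
Proof.
case: g => l c; apply/boundedP; split=> [a f h|].
  by apply: ind_ext => j; rewrite entryD entryZ !entry_Ind entryD entryZ; ring.
exists 1; split=> // f; rewrite mul1r; apply: nrm2_le => n.
rewrite /wsum (eq_bigr (fun j => sqnormc (entry f (j + l)))); last first.
  move=> j _; rewrite entry_Ind sqnormcM -[RHS]mul1r; congr (_ * _).
  by apply: (@complexI R); rewrite sqnormcE char_norm expr1n.
rewrite -(big_map (fun j => j + l) xpredT (fun j => sqnormc (entry f j))).
by rewrite sum_entry_le // map_inj_uniq ?window_uniq // => i j /addIr.
Qed.

Lemma Ind_delta l c k :
  Ind ((l, c) : G) (delta k) = chi (aut_pow alpha (k - l) c) *: delta (k - l).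
Proof.
apply: ind_ext => j; rewrite entry_Ind entryZ !entry_delta -subr_eq opprK.
by case: eqP => [<-|_]; rewrite ?addrK ?mulr0.
Qed.

Local Notation M := (Ind_commutant alpha chi).

(** [delta j] is a translate of [delta 0], and [T] commutes with shifts. *)
Lemma commutant_Toeplitz T j k : M T ->
  entry (T (delta j)) k = entry (T (delta 0)) (k - j).
Proof.
move=> [bT cT]; have -> : delta j = Ind ((- j, 0) : G) (delta 0).
  by rewrite Ind_delta aut_pow0 char0 scale1r add0r opprK.
by rewrite cT entry_Ind aut_pow0 char0 mul1r.
Qed.

Lemma commutant_comp S T : M S -> M T -> M (S \o T).
Proof.
move=> [bS cS] [bT cT]; split; first exact: bounded_comp.
by move=> g f /=; rewrite cT cS.
Qed.

Lemma commutant_ext S T : M S -> M T -> S (delta 0) = T (delta 0) -> S = T.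
Proof.
move=> mS mT ST; apply: bounded_ext => [||j]; [by case: mS|by case: mT|].
apply: ind_ext => k.
by rewrite [LHS]commutant_Toeplitz // ST [RHS]commutant_Toeplitz.
Qed.

(** Both products have the convolution of the two symbols as symbol, and
    convolution is commutative: substitute [k - j] for [j]. *)
Lemma commutant_comm S T : M S -> M T -> S \o T = T \o S.
Proof.
move=> mS mT; have [bS _] := mS; have [bT _] := mT.
apply: commutant_ext; [exact: commutant_comp..|].
apply: ind_ext => k /=.
set s := entry (S (delta 0)); set t := entry (T (delta 0)).
have STk : ccvg (wsum (fun j => t j * s (k - j))) (entry (S (T (delta 0))) k).
  apply: eq_ccvg (bounded_matrix (T (delta 0)) k bS) => n.
  by apply: eq_bigr => j _; rewrite (commutant_Toeplitz _ _ mS).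
have TSk : ccvg (wsum (fun j => s j * t (k - j))) (entry (T (S (delta 0))) k).
  apply: eq_ccvg (bounded_matrix (S (delta 0)) k bT) => n.
  by apply: eq_bigr => j _; rewrite (commutant_Toeplitz _ _ mT).
have v : vanishing (fun j => s j * t (k - j)).
  apply: (@vanishing_bound _ _ s (nrm2 (T (delta 0)))); last first.
    exact: vanishing_entry.
  by move=> j; rewrite sqnormcM mulrC ler_wpM2r ?sqnormc_ge0 ?entry_le.
apply: ccvg_unique STk _.
apply: eq_ccvg (ccvg_wsum_shift v TSk k) => n.
rewrite -wsum_opp; apply: eq_bigr => j _; rewrite mulrC [- j + k]addrC.
by congr (t _ * _); rewrite opprB addrCA subrr addr0.
Qed.

End Operators.

(** * Symmetries in the commutant *)

Section Symmetries.
Variables (R : realType) (B : zmodType) (alpha : aut B) (chi : dual_group R B).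
Local Notation C := R[i].
Local Notation G := (semidirect alpha).
Local Notation H := (ind_space alpha chi).
Local Notation inner := (@ind_inner R B alpha chi).
Local Notation bounded := (@bounded_operator R B alpha chi).
Local Notation M := (Ind_commutant alpha chi).
Local Notation delta := (delta alpha chi).
Local Open Scope complex_scope.

(** A self-adjoint unitary of the commutant: a multiplier with values [1] and
    [-1] on the Fourier side. *)
Definition symmetry (W : H -> H) :=
  [/\ M W, forall f, W (W f) = f & forall f g, inner (W f) g = inner f (W g)].

Section HermitianFamily.
Variable e : int -> H.
Hypothesis e_orth : forall k l, inner (e k) (e l) = (k == l)%:R.
Hypothesis e_herm : forall k l, entry (e k) l = (entry (e l) k)^*.

Lemma analysis_subproof (f : H) n :
  wsum (fun k => sqnormc (inner f (e k))) n <= nrm2 f.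
Proof. exact: bessel e_orth (window_uniq n). Qed.

(** The coefficients of [f] along [e], read in the basis [delta].  Hermitian
    symmetry makes the columns of the matrix of this operator the vectors [e k],
    so that it exchanges [delta k] and [e k]. *)
Definition analysis (f : H) : H := of_seq alpha chi (analysis_subproof f).

Lemma entry_analysis f k : entry (analysis f) k = inner f (e k).
Proof. exact: entry_of_seq. Qed.

Lemma analysis_nrm2_le f : nrm2 (analysis f) <= nrm2 f.
Proof.
apply: nrm2_le => n; under eq_fun do rewrite entry_analysis.
exact: analysis_subproof.
Qed.

Lemma analysis_linear : linear analysis.
Proof.
move=> a f g; apply: ind_ext => k.
by rewrite entryD entryZ !entry_analysis innerDl innerZl.
Qed.

Lemma bounded_analysis : bounded analysis.
Proof.
apply/boundedP; split; first exact: analysis_linear.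
by exists 1; split=> // f; rewrite mul1r analysis_nrm2_le.
Qed.

Lemma analysis_delta k : analysis (delta k) = e k.
Proof.
by apply: ind_ext => l; rewrite entry_analysis inner_deltal -e_herm.
Qed.

Lemma analysisK f : analysis (analysis f) = f.
Proof.
have : analysis \o analysis = id.
  apply: bounded_ext => [||k /=].
  - by apply: bounded_comp; exact: bounded_analysis.
  - exact: bounded_id.
  rewrite analysis_delta; apply: ind_ext => l.
  by rewrite entry_analysis e_orth entry_delta eq_sym.
by move=> /(congr1 (@^~ f)).
Qed.

Lemma analysis_nrm2 f : nrm2 (analysis f) = nrm2 f.
Proof.
apply/eqP; rewrite eq_le analysis_nrm2_le /=.
by rewrite -{1}(analysisK f) analysis_nrm2_le.
Qed.

(** An isometry preserves the inner product by polarization, and here it is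
    its own inverse. *)
Lemma analysis_selfadjoint f g : inner (analysis f) g = inner f (analysis g).
Proof.
have [lD lZ lB _] := linearP2 analysis_linear.
rewrite -{1}(analysisK g) !inner_polar.
by rewrite -!lZ -!lD -!lB !analysis_nrm2.
Qed.

Hypothesis e_shift : forall k l j, entry (e k) (j + l) = entry (e (k - l)) j.
Hypothesis e_supp : forall k j, entry (e k) j != 0 ->
  forall c, chi (aut_pow alpha j c) = chi (aut_pow alpha k c).

(** The matrix [e] is constant along diagonals, so it commutes with shifts; and
    it only links indices at which the diagonal operators [Ind (0, c)] have the
    same entry, so it commutes with these too. *)
Lemma analysis_symmetry : symmetry analysis.
Proof.
split; [|exact: analysisK|exact: analysis_selfadjoint].
split=> [|g f]; first exact: bounded_analysis.
suff : analysis \o Ind g = Ind g \o analysis by move=> /(congr1 (@^~ f)).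
have [_ lZ _ _] := linearP2 analysis_linear.
apply: bounded_ext => [||k].
- exact: bounded_comp bounded_analysis (bounded_Ind _ _).
- exact: bounded_comp (bounded_Ind _ _) bounded_analysis.
case: g => l c /=; rewrite Ind_delta lZ !analysis_delta.
apply: ind_ext => j; rewrite entryZ entry_Ind e_shift.
by have [->|/e_supp ->] := eqVneq (entry (e (k - l)) j) 0; rewrite ?mulr0.
Qed.

End HermitianFamily.

(** * The square wave *)

Section SquareWave.
Variable q : nat.

(** Odd multiples of [q], as a congruence class so that differences of two
    of them are visibly periods of the predicate. *)
Definition odd_multiple (m : int) : bool := (q.*2%:Z %| m - q%:Z)%Z.

Lemma odd_multipleN m : odd_multiple (- m) = odd_multiple m.
Proof.
rewrite /odd_multiple -[RHS]rpredN.
have -> : - (m - q%:Z) = q.*2%:Z * 1 + (- m - q%:Z) by lia.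
by rewrite [RHS]rpredDl ?dvdz_mulr.
Qed.

Lemma odd_multiple_shift m n j : odd_multiple m -> odd_multiple n ->
  odd_multiple (j + (m - n)) = odd_multiple j.
Proof.
rewrite /odd_multiple => om on.
have -> : j + (m - n) - q%:Z = (m - q%:Z) - (n - q%:Z) + (j - q%:Z) by lia.
by rewrite [LHS]rpredDl // rpredB.
Qed.

Lemma odd_multiple_self : odd_multiple q.
Proof. by rewrite /odd_multiple subrr dvdz0. Qed.

Lemma odd_multiple_dvd (d : nat) m : (d %| q)%N -> odd_multiple m ->
  (d%:Z %| m)%Z.
Proof.
move=> dq om; rewrite -(subrK q%:Z m) rpredD //.
by apply: dvdz_trans om; rewrite -muln2; exact: dvdn_mulr.
Qed.

(** Up to a scalar, the Fourier coefficients of a square wave of frequency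
    [q]. *)
Definition wave (m : int) : R := if odd_multiple m then m%:~R^-1 else 0.

Lemma waveN m : wave (- m) = - wave m.
Proof.
rewrite /wave odd_multipleN; case: ifP; rewrite ?oppr0 //.
by rewrite rmorphN invrN.
Qed.

Lemma wave_sq_le m : wave m ^+ 2 <= (m%:~R ^+ 2)^-1.
Proof.
rewrite /wave; case: ifP => _; first by rewrite exprVn.
by rewrite expr0n invr_ge0 sqr_ge0.
Qed.

Lemma wave_subproof n : wsum (fun m => sqnormc (wave m)%:C) n <= 4.
Proof.
have E m : sqnormc (wave m)%:C = wave m ^+ 2.
  by rewrite /sqnormc /= expr0n addr0.
(* A telescoping majorant of the partial sums of [2 / m ^ 2]. *)
suff h : wsum (fun m => sqnormc (wave m)%:C) n <= 4 - 4 / n.+1%:R.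
  by apply: le_trans h _; rewrite gerBl divr_ge0.
elim: n => [|n IH].
  rewrite wsum0 E divr1 subrr; apply: le_trans (wave_sq_le _) _.
  by rewrite expr0n invr0.
rewrite wsumS !E waveN sqrrN -addrA.
have := lerD IH (lerD (wave_sq_le n.+1) (wave_sq_le n.+1)).
move=> /le_trans; apply; rewrite -[n.+2%:R]natr1.
have : 0 < n.+1%:R :> R by rewrite ltr0n.
rewrite -[(n.+1 : int)%:~R]/(n.+1%:R); set x := n.+1%:R => x0.
have x1 : 0 < x + 1 by rewrite addr_gt0.
rewrite -subr_ge0.
have -> : 4 - 4 / (x + 1) - (4 - 4 / x + ((x ^+ 2)^-1 + (x ^+ 2)^-1)) =
    (2 * (x - 1)) / (x ^+ 2 * (x + 1)).
  by field; rewrite !gt_eqF.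
apply: divr_ge0; last by rewrite mulr_ge0 ?sqr_ge0 // ltW.
by rewrite mulr_ge0 // subr_ge0 ler1n.
Qed.

Definition wave_vector : H := of_seq alpha chi wave_subproof.

Lemma entry_wave m : entry wave_vector m = (wave m)%:C.
Proof. exact: entry_of_seq. Qed.

(** Normalizes the kernel; purely imaginary because [wave] is odd and the
    kernel has to be hermitian. *)
Definition wave_scale : C := (0 +i* (Num.sqrt (nrm2 wave_vector))^-1).

Definition wave_family (k : int) : H :=
  Ind ((- k, 0) : G) (wave_scale *: wave_vector).

Lemma entry_wave_family k j :
  entry (wave_family k) j = wave_scale * (wave (j - k))%:C.
Proof. by rewrite entry_Ind aut_pow0 char0 mul1r entryZ entry_wave. Qed.

Lemma wave_family_shift k l j :
  entry (wave_family k) (j + l) = entry (wave_family (k - l)) j.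
Proof. by rewrite !entry_wave_family; congr (_ * (wave _)%:C); lia. Qed.

Lemma wave_family_herm k l :
  entry (wave_family k) l = (entry (wave_family l) k)^*.
Proof.
rewrite !entry_wave_family -(opprB k l) waveN.
by apply: complex_ext => /=; ring.
Qed.

Lemma sqnormc_wave_scale : sqnormc wave_scale = (nrm2 wave_vector)^-1.
Proof. by rewrite /sqnormc /= expr0n add0r exprVn sqr_sqrtr ?nrm2_ge0. Qed.

Lemma wsum_wave_cvg k : ccvg (wsum (fun j => (wave (j - k))%:C)) 0.
Proof.
have v : vanishing (fun j => (wave j)%:C).
  by under eq_fun do rewrite -entry_wave; exact: vanishing_entry.
apply: (ccvg_wsum_shift v); apply: eq_ccvg (ccvg_cst 0) => n.
set s := wsum _ n; suff : s = - s.
  by move/eqP; rewrite -addr_eq0 -mulr2n mulrn_eq0 => /eqP.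
rewrite /s -[LHS]wsum_opp /wsum -sumrN; apply: eq_bigr => j _.
by rewrite waveN rmorphN.
Qed.

Hypothesis q_gt0 : (0 < q)%N.

Lemma odd_multiple_neq0 m : odd_multiple m -> m != 0.
Proof.
move=> om; apply/eqP => m0; move: om; rewrite /odd_multiple m0 sub0r.
by rewrite rpredN dvdzE => /dvdn_leq; rewrite /=; lia.
Qed.

Lemma nrm2_wave_gt0 : 0 < nrm2 wave_vector.
Proof.
rewrite lt_neqAle nrm2_ge0 andbT eq_sym; apply/eqP => /nrm2_eq0 w0.
have := entry_wave q; rewrite w0 entry0 => /esym /eqP.
rewrite /wave odd_multiple_self eq_complex /= eqxx andbT invr_eq0.
by rewrite intr_eq0; lia.
Qed.

(** If [k] and [l] differ by a nonzero even multiple of [q], partial fractions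
    turn the products of waves into [(wave (j - k) - wave (j - l)) / (k - l)],
    and both sums over [j] vanish since [wave] is odd.  For other distinct [k]
    and [l] the supports are disjoint. *)
Lemma wave_family_orth k l :
  inner (wave_family k) (wave_family l) = (k == l)%:R.
Proof.
(* The phase of the scale cancels, leaving the real products of waves. *)
have E j : entry (wave_family k) j * (entry (wave_family l) j)^* =
    (sqnormc wave_scale)%:C * ((wave (j - k))%:C * (wave (j - l))%:C).
  rewrite !entry_wave_family rmorphM -mulc_conj -!mulrA; congr (_ * _).
  rewrite mulrCA; congr (_ * _); rewrite mulrC -!rmorphM /=.
  by apply: complex_ext => /=; ring.
apply: inner_unique.
suff h : ccvg (wsum (fun j => (wave (j - k))%:C * (wave (j - l))%:C))
    ((k == l)%:R * (nrm2 wave_vector)%:C).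
  have -> : ((k == l)%:R : C) =
      (sqnormc wave_scale)%:C * ((k == l)%:R * (nrm2 wave_vector)%:C).
    rewrite mulrCA -rmorphM /= sqnormc_wave_scale mulVf ?mulr1 //.
    by rewrite gt_eqF ?nrm2_wave_gt0.
  apply: eq_ccvg (ccvgM (ccvg_cst _) h) => n.
  by rewrite /wsum mulr_sumr; apply: eq_bigr => j _; rewrite E.
have [->|kl] := eqVneq k l.
  have h : ccvg (wsum (fun j => (wave j)%:C * (wave j)%:C))
      (nrm2 wave_vector)%:C.
    rewrite -inner_nrm2; apply: eq_ccvg (inner_cvg _ _) => n.
    apply: eq_bigr => j _; rewrite entry_wave; congr (_ * _).
    by apply: complex_ext; rewrite //= oppr0.
  rewrite mul1r.
  apply: (@ccvg_wsum_shift _ (fun j => (wave j)%:C * (wave j)%:C)) => //.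
  apply: (@vanishing_bound _ _ (entry wave_vector) (nrm2 wave_vector)).
    by move=> j; rewrite -entry_wave sqnormcM ler_wpM2r ?sqnormc_ge0 ?entry_le.
  exact: vanishing_entry.
rewrite mul0r.
(* If one product is nonzero, [k - l] is an even multiple of [q], so the two
   factors are supported on the same [j]. *)
have [[i ik il]|no] :=
    pselect (exists2 i, odd_multiple (i - k) & odd_multiple (i - l));
  last first.
  apply: eq_ccvg (ccvg_cst 0) => n; rewrite /wsum big1 // => j _.
  rewrite /wave; case: ifP => jk; last by rewrite mul0r.
  case: ifP => jl; last by rewrite mulr0.
  by case: no; exists j.
have := ccvgM (ccvg_cst ((k - l)%:~R^-1))
  (ccvgD (wsum_wave_cvg k) (ccvgN (wsum_wave_cvg l))).
rewrite subr0 mulr0; apply: eq_ccvg => n.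
rewrite -wsumB /wsum mulr_sumr; apply: eq_bigr => j _.
have jkl : odd_multiple (j - k) = odd_multiple (j - l).
  rewrite -(odd_multiple_shift (j - l) ik il); congr odd_multiple; lia.
rewrite /wave jkl; case: ifP => jl; last by rewrite subr0 mulr0 mul0r.
have kl0 : (k - l)%:~R != 0 :> R by rewrite intr_eq0 subr_eq0.
have jl0 : (j - l)%:~R != 0 :> R by rewrite intr_eq0 odd_multiple_neq0.
have jk0 : (j - k)%:~R != 0 :> R by rewrite intr_eq0 odd_multiple_neq0 ?jkl.
rewrite -rmorphB -rmorphM.
have -> : ((k - l)%:~R : C) = ((k - l)%:~R)%:C by rewrite rmorph_int.
rewrite -fmorphV -rmorphM; congr (_%:C).
have e : (k - l)%:~R = (j - l)%:~R - (j - k)%:~R :> R.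
  by rewrite -rmorphB; congr (_%:~R); lia.
rewrite e in kl0 *; field.
by rewrite -!rmorphB jl0 jk0 rmorphB rmorphB in kl0 *.
Qed.

End SquareWave.

Variable p : nat.
Hypothesis orbit_p : iter p (dual_act alpha) chi = chi.

Lemma char_periodic k l : (p%:Z %| l - k)%Z ->
  forall c, chi (aut_pow alpha l c) = chi (aut_pow alpha k c).
Proof.
have it n (psi : dual_group R B) c :
    (iter n (dual_act alpha) psi) c = psi (iter n alpha c).
  by elim: n c => // n IH c; rewrite [in RHS]iterSr -IH.
have up c : chi (aut_pow alpha p c) = chi c by rewrite /= -it orbit_p.
have um (m : int) c : chi (aut_pow alpha (m * p%:Z) c) = chi c.
  elim/int_ind: m c => [|n IH|n IH] c; first by rewrite mul0r.
    by rewrite -addn1 PoszD mulrDl mul1r aut_powD IH up.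
  rewrite -[RHS]IH -[LHS]up -aut_powD; congr (chi (aut_pow _ _ c)).
  by rewrite -addn1 PoszD; ring.
move=> /dvdzP[m lk] c; have -> : l = m * p%:Z + k by rewrite -lk subrK.
by rewrite aut_powD um.
Qed.

Lemma wave_symmetry q (q_gt0 : (0 < q)%N) : (p %| q)%N ->
  symmetry (analysis (wave_family_orth q_gt0)).
Proof.
move=> pq; apply: analysis_symmetry => [||k j nz].
- exact: wave_family_herm.
- exact: wave_family_shift.
apply: char_periodic; apply: odd_multiple_dvd pq _.
move: nz; rewrite entry_wave_family /wave; case: ifP => //.
by rewrite mulr0 eqxx.
Qed.

End Symmetries.

(** * Minimal projections *)

Section MinimalProjections.
Variables (R : realType) (B : zmodType) (alpha : aut B) (chi : dual_group R B).
Local Notation C := R[i].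
Local Notation G := (semidirect alpha).
Local Notation H := (ind_space alpha chi).
Local Notation inner := (@ind_inner R B alpha chi).
Local Notation M := (Ind_commutant alpha chi).
Local Notation delta := (delta alpha chi).
Local Open Scope complex_scope.

(** The odd multiples of [q] and of an even multiple of [q] are disjoint. *)
Lemma wave_family_disjoint q q' (q_gt0 : (0 < q)%N) : (q.*2 %| q')%N ->
  inner (@wave_family _ _ alpha chi q 0) (@wave_family _ _ alpha chi q' 0) = 0.
Proof.
move=> qq'; apply: inner_unique; apply: eq_ccvg (ccvg_cst 0) => n.
rewrite /wsum big1 // => j _; rewrite !entry_wave_family subr0 /wave.
case: ifP => oq; last by rewrite mulr0 mul0r.
case: ifP => oq'; last by rewrite mulr0 rmorph0 mulr0.
have := rpredB (odd_multiple_dvd qq' oq') oq; rewrite subKr.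
by move=> /dvdn_leq; lia.
Qed.

Lemma symmetryN W : symmetry W -> symmetry (fun f : H => - W f).
Proof.
move=> [[bW cW] WK sW]; have [lD lZ _ _] := linearP2 (bounded_linear bW).
split=> [|f|f g].
- split=> [|g f].
    suff -> : (fun f : H => - W f) = (fun f => (-1) *: W f + 0 *: W f).
      exact: bounded_comb.
    by apply/funext => f; rewrite scaleN1r scale0r addr0.
  have [_ lZg _ _] := linearP2 (bounded_linear (bounded_Ind chi g)).
  by rewrite cW -[in RHS](scaleN1r (W f)) lZg scaleN1r.
- by rewrite -(scaleN1r (W f)) lZ WK scaleN1r opprK.
- rewrite -(scaleN1r (W f)) -(scaleN1r (W g)).
  by rewrite innerZl innerZr rmorphN1 sW.
Qed.

(** The spectral projection of a symmetry for the eigenvalue [1]. *)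
Definition spectral_half (W : H -> H) (f : H) : H := 2^-1 *: (f + W f).

Lemma half_double (f : H) : 2^-1 *: (f + f) = f.
Proof.
have e : 2^-1 + 2^-1 = 1 :> C by field.
by rewrite scalerDr -scalerDl e scale1r.
Qed.

Lemma spectral_half_commutant W : symmetry W -> M (spectral_half W).
Proof.
move=> [[bW cW] _ _]; split.
  have := bounded_comb 2^-1 2^-1 (bounded_id alpha chi) bW.
  by under eq_fun do rewrite -scalerDr.
move=> g f; have [lD lZ _ _] := linearP2 (bounded_linear (bounded_Ind chi g)).
by rewrite /spectral_half cW lZ lD.
Qed.

Lemma spectral_half_projection W : symmetry W -> projection (spectral_half W).
Proof.
move=> sW; have [bE _] := spectral_half_commutant sW.
case: sW => [[bW _] WK sW]; split=> // [f|f g].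
- have [lD lZ _ _] := linearP2 (bounded_linear bW).
  by rewrite /spectral_half lZ lD WK [W f + f]addrC half_double.
- rewrite /spectral_half innerZl innerZr innerDl innerDr sW.
  by rewrite fmorphV rmorph_nat.
Qed.

Lemma projection_comp P Q : M P -> M Q -> projection P -> projection Q ->
  projection (P \o Q).
Proof.
move=> mP mQ [bP PP sP] [bQ QQ sQ].
have PQ f : Q (P f) = P (Q f).
  by have := commutant_comm mQ mP; move=> /(congr1 (@^~ f)).
split=> [|f|f g]; first exact: bounded_comp.
- by rewrite /= PQ QQ PP.
- by rewrite /= sP sQ PQ.
Qed.

Lemma projection_inner P f : projection P -> inner (P f) f = (nrm2 (P f))%:C.
Proof. by move=> [_ PP sP]; rewrite -inner_nrm2 -sP PP. Qed.

(** Splitting [P] along the spectral projections [(1 + W) / 2] and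
    [(1 - W) / 2] must be trivial. *)
Lemma minimal_symmetry P W f : minimal_projection M P -> symmetry W ->
  P (W f) = P f \/ P (W f) = - P f.
Proof.
move=> [mP pP _ Pmin] sW; have [bP _ _] := pP.
have [lD lZ lB _] := linearP2 (bounded_linear bP).
set E := spectral_half W; set E' := spectral_half (fun f => - W f).
have mE : M E by exact: spectral_half_commutant.
have EE' g : g - E g = E' g.
  rewrite /E /E' /spectral_half -{1}(half_double g) -scalerBr.
  by rewrite opprD addrA addrK.
have [|||PE0|PEP] := Pmin (P \o E).
- exact: commutant_comp.
- by apply: projection_comp => //; exact: spectral_half_projection.
- move=> g; rewrite -subr_ge0 -innerBl /= -lB EE'.
  have pPE' : projection (P \o E').
    apply: projection_comp => //; first exact/spectral_half_commutant/symmetryN.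
    exact/spectral_half_projection/symmetryN.
  by rewrite (projection_inner g pPE') ler0c nrm2_ge0.
- right; have /(congr1 (@^~ f)) /= := PE0.
  rewrite /E /spectral_half lZ lD => PE0f; apply/eqP; rewrite -addr_eq0 addrC.
  by rewrite -[_ + _]half_double scalerDr PE0f addr0.
- left; have /(congr1 (@^~ f)) /= := PEP.
  rewrite /E /spectral_half lZ lD => PEPf; apply: (@addrI _ (P f)).
  by rewrite -[LHS]half_double scalerDr PEPf.
Qed.

Lemma no_minimal_projection (p : nat) : (0 < p)%N ->
  iter p (dual_act alpha) chi = chi ->
  ~ exists P, minimal_projection M P.
Proof.
move=> p_gt0 orbit_p [P Pmin]; have [mP pP P0 _] := Pmin.
have [bP PP sP] := pP; set h := P (delta 0).
have q_gt0 n : (0 < p * 2 ^ n)%N by rewrite muln_gt0 p_gt0 expn_gt0.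
pose e n := @wave_family _ _ alpha chi (p * 2 ^ n) 0.
have e_orth m n : inner (e m) (e n) = (m == n)%:R.
  have disj i j : (i < j)%N -> inner (e i) (e j) = 0.
    move=> ij; apply: wave_family_disjoint => //.
    by rewrite -muln2 -mulnA -expnSr dvdn_pmul2l // dvdn_exp2l.
  case: ltngtP => [/disj //|/disj mn|->].
    by rewrite inner_conj mn rmorph0.
  by rewrite wave_family_orth ?eqxx.
have he n : sqnormc (inner h (e n)) = sqnormc (entry h 0).
  have sW := wave_symmetry orbit_p (q_gt0 n) (dvdn_mulr _ (dvdnn p)).
  rewrite inner_conj sqnormc_conj -sP inner_deltar.
  have := minimal_symmetry (delta 0) Pmin sW.
  rewrite analysis_delta; last exact: wave_family_herm.
  by rewrite -/(e n) => -[] ->; rewrite ?entryN ?sqnormcN.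
have h0 : sqnormc (entry h 0) = 0.
  apply/eqP; apply: contraT => c0.
  (* Otherwise more than [|h|^2 / |h_0|^2] orthonormal vectors break Bessel. *)
  have {}c0 : 0 < sqnormc (entry h 0) by rewrite lt_def c0 sqnormc_ge0.
  have := bessel h e_orth
    (iota_uniq 0 (Num.bound (nrm2 h / sqnormc (entry h 0)))).
  under eq_bigr do rewrite he.
  rewrite big_const_seq count_predT size_iota iter_addr_0 -mulr_natl.
  rewrite -ler_pdivlMr // leNgt archi_boundP //.
  by rewrite divr_ge0 ?nrm2_ge0 ?sqnormc_ge0.
have hh : (nrm2 h)%:C = entry h 0.
  by rewrite -(projection_inner _ pP) inner_deltar.
have {}h0 : h = 0.
  by apply/nrm2_eq0/(@complexI R); rewrite hh (sqnormc_eq0 h0).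
apply: P0; apply: commutant_ext => //.
have -> : (fun=> 0 : H) = (fun f : H => 0 *: f + 0 *: f).
  by apply/funext => f; rewrite scale0r addr0.
split; first exact: bounded_comb (bounded_id _ _) (bounded_id _ _).
move=> g f; have [_ lZ _ _] := linearP2 (bounded_linear (bounded_Ind chi g)).
by rewrite !scale0r addr0 -[X in Ind _ X](scale0r (0 : H)) lZ scale0r.
Qed.

End MinimalProjections.

Theorem theorem3p9 (R : realType) (B : zmodType) (alpha : aut B)
    (chi : dual_group R B) (p : nat) (p_gt0 : (0 < p)%N)
    (orbit_p : iter p (dual_act alpha) chi = chi)
    (orbit_lt_p : forall k : nat, (1 <= k < p)%N ->
       iter k (dual_act alpha) chi <> chi) :
  (forall S T, Ind_commutant alpha chi S -> Ind_commutant alpha chi T ->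
     S \o T = T \o S) /\
  ~ (exists P, minimal_projection (Ind_commutant alpha chi) P).
Proof.
split; first exact: commutant_comm.
exact: no_minimal_projection p_gt0 orbit_p.
Qed.
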